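(* Let $2\leq l\leq k$ be integers. There is a polynomial $P_{k,l}$ (in one variable, depending only on $k$ and $l$) of degree $l$ with leading coefficient $\frac{(2k-l+1)\,k!}{2(l+1)}$ such that for every integer $n>2k$ coprime to $k$, the eigenvalue $\lambda_l=\lambda_l(n,k)$ of the $(n,k)$-wreath matrix satisfies $\lambda_l=(n-k-l)!\,P_{k,l}(n)$.
   Context: For positive integers $k<n/2$, $\mathbb{Z}_n$ is the set of integers modulo $n$ and $\mathbb{Z}_n^{(k)}$ is the set of its $k$-element subsets. For a bijection $\pi:\mathbb{Z}_n\to\mathbb{Z}_n$, let $\mathcal{F}_\pi=\{\{\pi((i-1)k+1),\ldots,\pi(ik)\} : i\in\mathbb{Z}_n\}\subset\mathbb{Z}_n^{(k)}$. An $(n,k)$-wreath is a family of the form $\mathcal{F}_\pi$; $\mathcal{W}_{n,k}$ is the set of all of them. The $(n,k)$-wreath matrix $M$ has rows and columns labelled by $\mathcal{W}_{n,k}$ and entries $M_{\mathcal{F},\mathcal{F}'}=|\mathcal{F}\cap\mathcal{F}'|$. Definition of $\lambda_l$ for $2\le l\le k$. Let $S_n$ be the group of permutations of $\mathbb{Z}_n$. Let $V$ be the complex vector space with basis $\{e_{\mathcal{F}}:\mathcal{F}\in\mathcal{W}_{n,k}\}$, with $S_n$ acting by $\tau e_{\mathcal{F}_\pi}=e_{\mathcal{F}_{\tau\pi}}$; $M$ acts on $V$. Let $V_k$ be the permutation $\mathbb{C}S_n$-module with basis $\{v_T:T\in\mathbb{Z}_n^{(k)}\}$, which decomposes as $V_k=\bigoplus_{i=0}^k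 U_i$ with $U_i$ isomorphic to the Specht module $S^{(n-i,i)}$. Let $\Phi:V_k\to V$ be the $\mathbb{C}S_n$-homomorphism $\Phi(v_T)=\sum_{\mathcal{F}\ni T}e_{\mathcal{F}}$, and let $E_l=\Phi(U_l)$, which for $2\le l\le k$ is isomorphic to $U_l$. The matrix $M$ acts on $E_l$ by multiplication by a scalar, and $\lambda_l$ denotes this scalar. *)

(* Defs.v *)
From mathcomp Require Import all_boot all_order all_algebra all_fingroup.
From mathcomp Require Import all_character.

Set Implicit Arguments.
Unset Strict Implicit.
Unset Printing Implicit Defensive.

Import GroupScope GRing.Theory.
Local Open Scope ring_scope.

(* 'Z_n is the ring of integers modulo n only for n > 1; the main result
   assumes 2 * k < n with 2 <= k.

   The product s * t of permutations is "s, then t", and representations act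
   on row vectors from the right, so v |-> v *m rG t is the left action of the
   permutation t in the usual notation. *)

Lemma sum_delta_enum_val (R : pzRingType) (X : finType) (A : {set X}) (a : X)
    (aA : a \in A) (f : X -> R) :
  \sum_(j < #|A|) (a == enum_val j)%:R * f (enum_val j) = f a.
Proof.
rewrite -(big_enum_val (fun x => (a == x)%:R * f x)) /= (bigD1 a) //= eqxx.
rewrite mul1r big1 ?addr0 // => x /andP[_ /negPf ne_x].
by rewrite eq_sym ne_x mul0r.
Qed.

Section PermutationModule.

Variables (C : fieldType) (aT : finGroupType) (X : finType).
Variables (to : {action aT &-> X}) (A : {set X}).

Definition permutation_mx (g : aT) : 'M[C]_#|A| :=
  \matrix_(i, j) (to (enum_val i) g == enum_val j)%:R.

Hypothesis actsA : [acts [set: aT], on A | to].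

Lemma permutation_mx_repr : mx_repr [set: aT] permutation_mx.
Proof.
split=> [|g h _ _]; apply/matrixP=> i j; rewrite !mxE.
  by rewrite act1 (inj_eq enum_val_inj).
have gA : to (enum_val i) g \in A by rewrite (acts_act actsA) ?inE ?enum_valP.
under eq_bigr do rewrite !mxE.
by rewrite (sum_delta_enum_val gA (fun x => (to x h == enum_val j)%:R)) actM.
Qed.

(* The basis vector of index i : 'I_#|A| corresponds to enum_val i \in A. *)
Definition permutation_repr := MxRepresentation permutation_mx_repr.

End PermutationModule.

(* The cells of the Young diagram of a partition sh of n are numbered
   0, ..., n - 1 row by row; a tableau of shape sh is the bijection t sending
   each cell to its entry, so t^-1 x is the cell containing x. *)
Section Specht.

Variables (C : fieldType) (n : nat) (sh : seq nat).
Implicit Types (t s : {perm 'Z_n}) (x : 'Z_n).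

Definition row_of t x : nat := reshape_index sh (t^-1%g x).
Definition column_of t x : nat := reshape_offset sh (t^-1%g x).

(* The row-equivalence class of t. *)
Definition tabloid t : {set {perm 'Z_n}} :=
  [set t' : {perm 'Z_n} | [forall x, row_of t' x == row_of t x]].

Definition tabloids : {set {set {perm 'Z_n}}} := [set tabloid t | t : {perm 'Z_n}].

Definition column_stabilizer t : {set {perm 'Z_n}} :=
  [set s : {perm 'Z_n} | [forall x, column_of t (s x) == column_of t x]].

Lemma tabloidM t s : tabloid t :* s = tabloid (t * s)%g.
Proof.
apply/setP=> t'; rewrite mem_rcoset !inE; apply/forallP/forallP=> eq_row x.
  move/eqP: (eq_row (s^-1%g x)).
  by rewrite /row_of !invMg invgK !permM permKV => ->.
move/eqP: (eq_row (s x)).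
by rewrite /row_of !invMg invgK !permM permK => ->.
Qed.

Lemma acts_tabloids : [acts [set: {perm 'Z_n}], on tabloids | 'Rs].
Proof.
apply/actsP=> s _ T; rewrite [in LHS]/= rcosetE.
apply/imsetP/imsetP=> -[t _ eqT]; last first.
  by exists (t * s)%g; rewrite ?inE // eqT tabloidM.
exists (t * s^-1)%g; rewrite ?inE //.
by rewrite -tabloidM -eqT -rcosetM mulgV rcoset1.
Qed.

Definition tabloid_repr :
  mx_representation C [set: {perm 'Z_n}]%G #|tabloids| :=
  permutation_repr C acts_tabloids.

Definition tabloid_vector (T : {set {perm 'Z_n}}) : 'rV[C]_#|tabloids| :=
  \row_j (T == enum_val j)%:R.

Definition polytabloid t : 'rV[C]_#|tabloids| :=
  \sum_(s in column_stabilizer t) (-1) ^+ s *: tabloid_vector (tabloid (t * s)).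

Definition specht_mx : 'M[C]_#|tabloids| := (\sum_t <<polytabloid t>>)%MS.

Lemma tabloid_vectorM t s :
  tabloid_vector (tabloid t) *m tabloid_repr s
    = tabloid_vector (tabloid (t * s)).
Proof.
have tT : tabloid t \in tabloids by apply: imset_f; rewrite inE.
apply/rowP=> j; rewrite !mxE -tabloidM -rcosetE; under eq_bigr do rewrite !mxE.
by rewrite (sum_delta_enum_val tT (fun T => (rcoset T s == enum_val j)%:R)).
Qed.

Lemma polytabloidM t g :
  polytabloid t *m tabloid_repr g = polytabloid (t * g).
Proof.
rewrite mulmx_suml [RHS](reindex_inj (conjg_inj g)) /=.
apply: eq_big => [s|s _]; last first.
  rewrite -scalemxAl tabloid_vectorM odd_permJ.
  by rewrite -!mulgA mulKVg.
rewrite !inE; apply/forallP/forallP=> eq_col x.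
  move/eqP: (eq_col (g^-1%g x)).
  by rewrite /column_of !invMg !permM permK => ->.
move/eqP: (eq_col (g x)).
by rewrite /column_of !invMg !permM !permK => ->.
Qed.

Lemma specht_module : mxmodule tabloid_repr specht_mx.
Proof.
apply/mxmoduleP=> g _; rewrite sumsmxMr; apply/sumsmx_subP=> t _.
rewrite (eqmxMr _ (genmxE _)) polytabloidM.
by rewrite (sumsmx_sup (t * g)%g) // genmxE.
Qed.

Definition specht_repr := submod_repr specht_module.

End Specht.

Section Wreath.

Variables (C : fieldType) (n k : nat).

Definition ksubsets : {set {set 'Z_n}} := [set T : {set 'Z_n} | #|T| == k].

Lemma acts_ksubsets : [acts [set: {perm 'Z_n}], on ksubsets | 'P^*].
Proof.
apply/actsP=> s _ T /=; rewrite !inE /setact card_imset //.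
exact: act_inj.
Qed.

Definition ksubset_repr :
  mx_representation C [set: {perm 'Z_n}]%G #|ksubsets| :=
  permutation_repr C acts_ksubsets.

(* {pi((i-1)k+1), ..., pi(ik)}; here j runs over 0, ..., k - 1 *)
Definition wreath_block (pi : {perm 'Z_n}) (i : 'Z_n) : {set 'Z_n} :=
  [set pi ((i - 1) * k%:R + j.+1%:R) | j : 'I_k].

Definition wreath (pi : {perm 'Z_n}) : {set {set 'Z_n}} :=
  [set wreath_block pi i | i : 'Z_n].

Definition wreaths : {set {set {set 'Z_n}}} := [set wreath pi | pi : {perm 'Z_n}].

Definition wreath_mx : 'M[C]_#|wreaths| :=
  \matrix_(i < #|wreaths|, j < #|wreaths|) #|enum_val i :&: enum_val j|%:R.

(* The matrix of Phi : v_T |-> \sum_(F containing T) e_F. *)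
Definition Phi : 'M[C]_(#|ksubsets|, #|wreaths|) :=
  \matrix_(i < #|ksubsets|, j < #|wreaths|) (enum_val i \in enum_val j)%:R.

(* U : 'M_#|ksubsets| stands for its row space. *)
Definition is_specht_submodule (i : nat) (U : 'M[C]_#|ksubsets|) : Prop :=
  exists modU : mxmodule ksubset_repr U,
    mx_rsim (submod_repr modU) (specht_repr C n [:: n - i; i]%N).

Definition specht_decomposition (U : nat -> 'M[C]_#|ksubsets|) : Prop :=
  [/\ forall i, (i <= k)%N -> is_specht_submodule i (U i),
      mxdirect (\sum_(i < k.+1) U i)
    & (\sum_(i < k.+1) U i :=: 1%:M)%MS].

(* As E is nonzero, there is at most one such scalar. *)
Definition acts_as_scalar m (E : 'M[C]_(m, #|wreaths|)) (lambda : C) : Prop :=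
  E != 0 /\ (E <= eigenspace wreath_mx lambda)%MS.

End Wreath.

(* Main.v *)
Require Import Defs.
From mathcomp Require Import all_boot all_order all_algebra all_fingroup.
From mathcomp Require Import all_character.
From mathcomp Require Import zify ring.
Import GRing.Theory Num.Theory.
Local Open Scope ring_scope.
Set Implicit Arguments.
Unset Strict Implicit.
Unset Printing Implicit Defensive.

(** Since [k] is invertible modulo [n], the blocks of a wreath are all the [n]
    arcs of length [k] of a cyclic arrangement of [Z_n]. The wreath matrix is
    [Phi^T Phi], so on the image of [U_l] under [Phi] it acts as the matrix
    [N = Phi Phi^T] acts on [U_l]; the entry of [N] at [T, T'] counts the wreaths
    that contain both [T] and [T'].

    For [l] disjoint pairs [(a_i, b_i)] put
    [w(T) = prod_i ([a_i \in T] - [b_i \in T])]. The vector [w] changes sign under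
    each transposition [(a_i b_i)] and is fixed by the transpositions of two
    other points, and up to a scalar it is the only vector of the space of
    [k]-subsets to do so ([weight_unique]). This has two consequences.
    The polytabloid with columns [{a_i, b_i}] has the same symmetries and
    generates the Specht module, so every copy [U_l] of it is spanned by the
    vectors [w], over all choices of the pairs ([specht_submodule_weights]).
    And as [N] commutes with permutations, each [w] is an eigenvector
    of [N], for an eigenvalue [a] that is the same for all of them
    ([weight_row_eigen]).

    To compute [a], the quadratic forms [w N w^T] and [w w^T] are summed over all
    choices of pairs and the results compared. Both reduce to the sum of
    [w(T) w(T')] over all choices, which depends only on the sizes [p, q, r, t] of
    [T :&: T'], [T :\: T'], [T' :\: T] and the complement of [T :|: T']: one pair
    contributes [+1] if it consists of a point in both sets and a point in
    neither, [-1] if it consists of a point in [T] only and a point in [T'] only,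
    and [0] otherwise. This is [sum_weight], with value [2^l] times
    [cross l p q r t], the sum over [s] of
    [(-1)^s C(l,s) p^_(l-s) q^_s r^_s t^_(l-s)]. For [w N w^T] it is
    applied to pairs of arcs, and the number of wreaths enters: it is
    [n! / 2n], because the stabilizer of a wreath is dihedral ([card_wreaths]).
    The outcome ([eigenvalueE]) is
    [a = (k-l)! (n-k-l)! / 2 * sum_d cross l j (k-j) (k-j) (n-2k+j)], where [d]
    runs over [Z_n] and [j] is the size of the intersection of two arcs at
    distance [d].

    Here [j = k] occurs once, each [0 < j < k] twice and [j = 0] occurs
    [n-2k+1] times, so the sum is a polynomial in [n]. Its terms of degree [l] come
    from [s = 0] and [j >= l], and a hockey-stick summation gives the leading
    coefficient ([coef_eigenvalue_poly]). Finally [Phi] does not vanish on [U_l]: the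
    pairs can be placed so that exactly one arc of a given wreath separates all
    of them ([weight_row_Phi_neq0]). *)

(** * A signed sum of falling factorials *)

Section Cross.
Variable R : comNzRingType.

(** The number of ways of choosing in turn [l] disjoint pairs, each made of a
    [p]-point and a [t]-point or of a [q]-point and an [r]-point, counted with a
    sign for each pair of the second kind. *)
Definition cross (l p q r t : nat) : R :=
  \sum_(s < l.+1) (-1) ^+ s
     * ('C(l, s) * (p ^_ (l - s) * q ^_ s * r ^_ s * t ^_ (l - s)))%:R.

(** The two terms are the two kinds of first pair; on the explicit sum, this is
    Pascal's rule for ['C(l.+1, s)]. *)
Lemma crossS l p q r t :
  cross l.+1 p q r t = (p * t)%:R * cross l p.-1 q r t.-1
                     - (q * r)%:R * cross l p q.-1 r.-1 t.
Proof.
pose F s : R := (p ^_ (l.+1 - s) * q ^_ s * r ^_ s * t ^_ (l.+1 - s))%:R.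
have -> : (p * t)%:R * cross l p.-1 q r t.-1
    = \sum_(s < l.+2) (-1) ^+ s * (('C(l, s))%:R * F s).
  rewrite [RHS]big_ord_recr /= bin_small // mul0r mulr0 addr0 mulr_sumr.
  apply: eq_bigr => -[s /= s_le] _; rewrite /F subSn // !ffactnS !natrM; ring.
have -> : - ((q * r)%:R * cross l p q.-1 r.-1 t)
    = \sum_(s < l.+1) (-1) ^+ s.+1 * (('C(l, s))%:R * F s.+1).
  rewrite mulr_sumr -sumrN.
  apply: eq_bigr => -[s /= s_le] _; rewrite /F subSS !ffactnS !natrM exprS; ring.
rewrite /cross big_ord_recl [X in _ = X + _]big_ord_recl !bin0 -addrA.
congr (_ + _); first by rewrite natrM.
rewrite -big_split; apply: eq_bigr => s _ /=.
by rewrite /bump /= add1n binS natrM natrD -mulrDr mulrDl.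
Qed.
Lemma cross_diag l p t : cross l p 0 0 t = (p ^_ l * t ^_ l)%:R.
Proof.
rewrite /cross big_ord_recl big1 => [|s _].
  by rewrite bin0 subn0 !ffactn0 !muln1 mul1n mul1r addr0.
by rewrite /= !ffact0n !(muln0, mul0n) mulr0.
Qed.
End Cross.

(** * Correlation of the pair weights of two sets *)

Section Pairings.
Variable X : finType.
Implicit Types (T D : {set X}) (ps : seq (X * X)).

(** All lists of [l] disjoint ordered pairs of points of [D]. The recursion
    removes the points already used, which is what makes the correlations below
    satisfy the recursion [crossS]. *)
Fixpoint pairings (l : nat) D : seq (seq (X * X)) :=
  if l is l'.+1 then
    flatten [seq flatten [seq [seq (x, y) :: ps | ps <- pairings l' (D :\ x :\ y)]
                         | y <- enum (D :\ x)] | x <- enum D]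
  else [:: [::]].

Lemma sum_pairingsS (R : nmodType) l D (F : seq (X * X) -> R) :
  \sum_(ps <- pairings l.+1 D) F ps
   = \sum_(x in D) \sum_(y in D :\ x)
       \sum_(ps <- pairings l (D :\ x :\ y)) F ((x, y) :: ps).
Proof.
rewrite /= big_flatten big_map big_enum; apply: eq_bigr => x _.
rewrite big_flatten big_map big_enum; apply: eq_bigr => y _.
by rewrite big_map.
Qed.

Definition points ps := unzip1 ps ++ unzip2 ps.

Lemma perm_points_cons x y ps :
  perm_eq (points ((x, y) :: ps)) [:: x, y & points ps].
Proof. by rewrite /points /= perm_cons perm_catC /= perm_cons perm_catC. Qed.

Lemma pairingsP l D ps :
  ps \in pairings l D ->
  [/\ size ps = l, uniq (points ps) & {subset points ps <= D}].
Proof.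
elim: l D ps => [|l IHl] D ps /=; first by rewrite inE => /eqP ->.
case/flattenP=> _ /mapP[x xD ->] /flattenP[_ /mapP[y yD ->]] /mapP[ps' /IHl].
move: xD yD; rewrite !mem_enum => xD yD [<- Ups Sps] ->.
split=> //; last first.
  move=> z; rewrite (perm_mem (perm_points_cons _ _ _)) !inE.
  case/or3P=> [/eqP-> //|/eqP->|/Sps]; first by case/setD1P: yD.
  by rewrite !inE => /and3P[].
rewrite (perm_uniq (perm_points_cons _ _ _)) /= Ups andbT inE negb_or.
case/setD1P: yD => neyx _; rewrite eq_sym neyx /=.
by apply/andP; split; apply/negP=> /Sps; rewrite !inE eqxx ?andbF.
Qed.

Variable R : comNzRingType.

(** On the subsets of a given size this is, up to a scalar, the image of the
    polytabloid whose columns of length two are the pairs. *)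
Definition weight ps T : R := \prod_(p <- ps) ((p.1 \in T)%:R - (p.2 \in T)%:R).

Lemma weight_cons p ps T :
  weight (p :: ps) T = ((p.1 \in T)%:R - (p.2 \in T)%:R) * weight ps T.
Proof. by rewrite /weight big_cons. Qed.

Lemma sum_indicator_pairs D (A B : {set X}) (z : R) :
  A \subset D -> B \subset D -> [disjoint A & B] ->
  \sum_(x in D) \sum_(y in D :\ x) ((x \in A) && (y \in B))%:R * z
  = (#|A| * #|B|)%:R * z.
Proof.
move=> sAD sBD dAB; rewrite natrM -[#|A|]sum1_card natr_sum !mulr_suml.
rewrite [LHS](big_setID A) /= (setIidPr sAD) [X in _ + X]big1 ?addr0; last first.
  by move=> x /setDP[_ /negPf->]; rewrite big1 // => y _; rewrite mul0r.
apply: eq_bigr => x xA; rewrite mul1r -[#|B|]sum1_card natr_sum mulr_suml.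
have sBDx : B \subset D :\ x.
  by rewrite subsetD1 sBD; move/pred0P/(_ x): dAB; rewrite /= xA /= => ->.
rewrite (big_setID B) /= (setIidPr sBDx) [X in _ + X]big1 ?addr0; last first.
  by move=> y /setDP[_ /negPf->]; rewrite xA mul0r.
by apply: eq_bigr => y yB; rewrite xA yB.
Qed.

Definition cross_sets l D T T' : R :=
  cross R l #|D :&: (T :&: T')| #|D :&: (T :\: T')| #|D :&: (T' :\: T)|
            #|D :&: ~: (T :|: T')|.

(** In this form a single case analysis on the regions containing [x] and [y]
    updates all four cardinals of [cross_sets]. *)
Lemma card_remove2I D (A : {set X}) x y : y \in D :\ x ->
  #|(D :\ x :\ y) :&: A| = (#|D :&: A| - ((x \in D :&: A) + (y \in D :&: A)))%N.
Proof.
case/setD1P => neyx _.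
have -> : (D :\ x :\ y) :&: A = (D :&: A) :\ x :\ y.
  by apply/setP=> z; rewrite !inE -!andbA.
rewrite [#|D :&: A|](cardsD1 x) [#|(D :&: A) :\ x|](cardsD1 y) !inE neyx /=.
by rewrite addnA addKn.
Qed.

(** Induction on [l]: for the first pair [(x, y)] the product of the two factors
    is [1] when one point lies in both sets and the other in neither, [-1] when
    each set contains exactly one of them and not the same one, [0] otherwise. The
    two orders of the pair give the factor 2. *)
Lemma sum_weight l D T T' :
  \sum_(ps <- pairings l D) weight ps T * weight ps T'
  = 2 ^+ l * cross_sets l D T T'.
Proof.
elim: l D => [|l IHl] D.
  rewrite big_seq1 /weight !big_nil /cross_sets /cross big_ord_recl big_ord0.
  by rewrite /= !mul1r addr0.
pose P := D :&: (T :&: T'); pose Q := D :&: (T :\: T').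
pose S := D :&: (T' :\: T); pose O := D :&: ~: (T :|: T').
pose A : R := 2 ^+ l * cross R l #|P|.-1 #|Q| #|S| #|O|.-1.
pose B : R := 2 ^+ l * cross R l #|P| #|Q|.-1 #|S|.-1 #|O|.
rewrite sum_pairingsS.
transitivity (\sum_(x in D) \sum_(y in D :\ x)
  (((x \in P) && (y \in O))%:R * A + ((x \in O) && (y \in P))%:R * A
   - (((x \in Q) && (y \in S))%:R * B + ((x \in S) && (y \in Q))%:R * B))).
  apply: eq_bigr => x xD; apply: eq_bigr => y yD.
  under eq_bigr do rewrite !weight_cons mulrACA.
  rewrite -mulr_sumr IHl /cross_sets !card_remove2I // /= {}/A {}/B.
  rewrite -/P -/Q -/S -/O.
  have yD' : y \in D by case/setD1P: yD.
  rewrite /P /Q /S /O !inE xD yD' /=.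
  by do 4![case: (_ \in _)]; rewrite /= ?subn0 ?subn1; ring.
under eq_bigr do rewrite sumrB !big_split /=.
have dPO : [disjoint P & O].
  by apply/pred0P=> z; rewrite !inE; do 3![case: (_ \in _)].
have dQS : [disjoint Q & S].
  by apply/pred0P=> z; rewrite !inE; do 3![case: (_ \in _)].
rewrite sumrB !big_split /= !sum_indicator_pairs ?subsetIl //;
  try by rewrite disjoint_sym.
rewrite /cross_sets crossS -/P -/Q -/S -/O /A /B exprS !natrM; ring.
Qed.
End Pairings.

(** * The symmetries that characterize a pair weight *)

Section Symmetry.
Variable X : finType.
Implicit Types (T : {set X}) (ps : seq (X * X)) (g : {perm X}).

Definition map_pairs g ps := [seq (g p.1, g p.2) | p <- ps].

(** A finite injection extends to a permutation, by correcting one value at a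
    time with a transposition. *)
Lemma perm_map_exists (s s' : seq X) :
  uniq s -> uniq s' -> size s = size s' -> exists g : {perm X}, map g s = s'.
Proof.
elim: s s' => [|x s IHs] [|x' s'] //=; first by exists 1%g.
case/andP=> xs Us /andP[xs' Us'] [/(IHs _ Us Us')[g def_s']].
exists (g * tperm (g x) x')%g; rewrite permM tpermL; congr (_ :: _).
rewrite -[RHS]def_s'; apply/eq_in_map => z zs; rewrite permM tpermD //.
  by rewrite (inj_eq perm_inj); apply: contraNneq xs => ->.
by apply: contraNneq xs' => ->; rewrite -def_s' map_f.
Qed.

Lemma map_pairs_exists ps ps' :
  uniq (points ps) -> uniq (points ps') -> size ps = size ps' ->
  exists g, map_pairs g ps = ps'.
Proof.
move=> Ups Ups' eq_size.
have [|g] := perm_map_exists Ups Ups'; rewrite /points.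
  by rewrite !size_cat !size_map eq_size.
rewrite map_cat => /eqP; rewrite eqseq_cat ?size_map // => /andP[/eqP e1 /eqP e2].
exists g; rewrite -(zip_unzip ps') -e1 -e2; elim: ps {Ups eq_size e1 e2} => //= p ps.
by rewrite /map_pairs /= => ->.
Qed.

Variable R : numFieldType.

Lemma weight_map_pairs g ps T : weight R (map_pairs g ps) (g @: T) = weight R ps T.
Proof.
rewrite /weight /map_pairs big_map; apply: eq_bigr => p _.
by rewrite /= !mem_imset //; apply: perm_inj.
Qed.

Lemma mem_tperm_imset (x y z : X) T : (z \in tperm x y @: T) = (tperm x y z \in T).
Proof. by rewrite -{1}[z](tpermK x y) mem_imset //; apply: perm_inj. Qed.

Lemma perm_points_rem p ps :
  p \in ps -> perm_eq (points ps) [:: p.1, p.2 & points (rem p ps)].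
Proof.
move=> /perm_to_rem pps.
rewrite -(permPr (perm_points_cons p.1 p.2 (rem p ps))) -surjective_pairing.
by rewrite /points perm_cat // perm_map.
Qed.

Lemma weight_fix (x y : X) ps T : x \notin points ps -> y \notin points ps ->
  weight R ps (tperm x y @: T) = weight R ps T.
Proof.
rewrite /points !mem_cat !negb_or => /andP[x1 x2] /andP[y1 y2].
apply: eq_big_seq => q qps; rewrite !mem_tperm_imset.
have [q1 q2] : q.1 \in unzip1 ps /\ q.2 \in unzip2 ps by rewrite !map_f.
by rewrite !tpermD //; apply/eqP=> e; move: x1 x2 y1 y2; rewrite e ?q1 ?q2.
Qed.

Lemma weight_flip p ps T : uniq (points ps) -> p \in ps ->
  weight R ps (tperm p.1 p.2 @: T) = - weight R ps T.
Proof.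
move=> Ups pps; rewrite /weight (big_rem p) //= [in RHS](big_rem p) //=.
move: Ups; rewrite (perm_uniq (perm_points_rem pps)) /= inE negb_or.
case/and3P=> /andP[_ p1] p2 _.
rewrite -/(weight R (rem p ps) _) -/(weight R (rem p ps) T) weight_fix //.
rewrite !mem_tperm_imset tpermL tpermR; ring.
Qed.

Lemma weight_neq0P ps T :
  reflect {in ps, forall p, (p.1 \in T) = (p.2 \notin T)} (weight R ps T != 0).
Proof.
rewrite /weight prodf_seq_neq0; apply: (iffP allP) => wT p /wT.
  by case: (_ \in T); case: (_ \in T); rewrite //= subrr eqxx.
by move=> ->; case: (_ \in T); rewrite /= ?sub0r ?subr0 ?oppr_eq0 oner_eq0.
Qed.

Lemma weight_sqr ps T : weight R ps T != 0 -> weight R ps T * weight R ps T = 1.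
Proof.
rewrite -expr2 /weight -prodrXl => /weight_neq0P wT; apply: big1_seq => p /= /wT ->.
by case: (_ \in T); rewrite /= ?sub0r ?subr0 ?sqrrN expr1n.
Qed.

(** A set that does not separate some pair is fixed by the transposition of that
    pair, so [F] vanishes there. Two separating sets [T], [T'] of the same size are
    joined by transpositions that swap either the two points of a pair or two
    points outside all pairs; both [F] and the weight follow the same sign rule
    along the way, so [F T * weight T] is constant, and the weight is its own
    inverse where it is nonzero. *)
Lemma weight_unique (k : nat) ps (F : {set X} -> R) : uniq (points ps) ->
  (forall p T, p \in ps -> #|T| = k -> F (tperm p.1 p.2 @: T) = - F T) ->
  (forall x y T, x \notin points ps -> y \notin points ps -> #|T| = k ->
     F (tperm x y @: T) = F T) ->
  exists c, forall T, #|T| = k -> F T = c * weight R ps T.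
Proof.
move=> Ups Fflip Ffix.
have cardJ x y T : #|tperm x y @: T| = #|T| by rewrite card_imset //; apply: perm_inj.
have F0 T : #|T| = k -> weight R ps T = 0 -> F T = 0.
  move=> Tk /eqP; rewrite -[_ == 0]negbK => /weight_neq0P w0.
  suff: has (fun p => (p.1 \in T) == (p.2 \in T)) ps.
    case/hasP=> p pps /eqP eqT; have:= Fflip p T pps Tk.
    have -> : tperm p.1 p.2 @: T = T.
      by apply/setP=> z; rewrite mem_tperm_imset; case: tpermP => // ->.
    by move/eqP; rewrite -addr_eq0 -mulr2n mulrn_eq0 => /eqP.
  apply: contra_notT w0 => /hasPn w0 p /w0.
  by case: (_ \in T); case: (_ \in T).
have FE T T' : #|T| = k -> #|T'| = k -> weight R ps T != 0 -> weight R ps T' != 0 ->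
    F T * weight R ps T = F T' * weight R ps T'.
  (* A suitable transposition brings T closer to T', keeping F T * weight T. *)
  elim: {T}_.+1 {-2}T (ltnSn #|T :\: T'|) => // m IHm T leTm Tk T'k wT wT'.
  have [-> // | neqT] := eqVneq T T'.
  have cardTD : #|T :\: T'| = #|T' :\: T|.
    by apply/eqP; rewrite -(eqn_add2l #|T :&: T'|) cardsID setIC cardsID Tk T'k.
  have [x [y [xD yD]]] : exists x y, [/\ x \in T :\: T', y \in T' :\: T &
        F (tperm x y @: T) * weight R ps (tperm x y @: T) = F T * weight R ps T
      /\ weight R ps (tperm x y @: T) != 0].
    (* If the sets disagree on some pair, swap that pair; else swap free points. *)
    have [/hasP[p pps neq_p] | /hasPn eq_ps] :=
        boolP (has (fun p => (p.1 \in T) != (p.1 \in T')) ps).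
      have:= (weight_neq0P _ _ wT p pps, weight_neq0P _ _ wT' p pps).
      case: (boolP (p.1 \in T)) neq_p => [p1T|p1T].
        move=> neq_p [/esym/negPf p2T e']; exists p.1, p.2.
        have p1T' : (p.1 \in T') = false by case: (p.1 \in T') neq_p.
        have p2T' : p.2 \in T' by rewrite -[_ \in _]negbK -e' p1T'.
        rewrite !inE p1T p1T' p2T p2T'.
        by split=> //; rewrite weight_flip // Fflip // mulrNN oppr_eq0.
      move=> neq_p [/esym/negbFE p2T e']; exists p.2, p.1.
      have {}p1T' : p.1 \in T' by case: (p.1 \in T') neq_p.
      rewrite p1T' in e'; rewrite !inE (negPf p1T) p2T p1T' -e'.
      by split=> //; rewrite tpermC weight_flip // Fflip // mulrNN oppr_eq0.
    have [x xD] : exists x, x \in T :\: T'.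
      apply/set0Pn; rewrite setD_eq0; apply: contra neqT => sTT'.
      by rewrite eqEcard sTT' Tk T'k leqnn.
    have [y yD] : exists y, y \in T' :\: T.
      by apply/card_gt0P; rewrite -cardTD; apply/card_gt0P; exists x.
    exists x, y; split=> //.
    have notin z : (z \in T) != (z \in T') -> z \notin points ps.
      apply: contra; rewrite mem_cat => /orP[] /mapP[p pps ->].
        by have := eq_ps p pps; rewrite negbK.
      have:= eq_ps p pps; rewrite negbK (weight_neq0P _ _ wT) //.
      by rewrite (weight_neq0P _ _ wT') // => /eqP/negb_inj->.
    have xps : x \notin points ps.
      by apply: notin; case/setDP: xD => -> /negPf->.
    have yps : y \notin points ps.
      by apply: notin; case/setDP: yD => -> /negPf->.
    by rewrite weight_fix // Ffix.
  case=> <- wT1; apply: IHm; rewrite ?cardJ //.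
  rewrite -ltnS; apply: leq_trans leTm; rewrite ltnS.
  have sub: tperm x y @: T :\: T' \proper T :\: T'.
    case/setDP: (xD) => xT xT'; case/setDP: (yD) => yT' yT.
    apply/properP; split; last first.
      by exists x => //; rewrite inE mem_tperm_imset tpermL (negPf yT) andbF.
    apply/subsetP=> z; rewrite !inE mem_tperm_imset => /andP[zT'].
    case: tpermP => [_ | zy | _ _ ->]; rewrite ?zT' ?(negPf yT) //.
    by rewrite zy yT' in zT'.
  exact: proper_card.
have [/existsP[T0 /andP[/eqP T0k wT0]] | /existsPn w0] :=
    boolP [exists T : {set X}, (#|T| == k) && (weight R ps T != 0)].
  exists (F T0 * weight R ps T0) => T Tk.
  have [/eqP wT | wT] := boolP (weight R ps T == 0).
    by rewrite F0 // wT mulr0.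
  by rewrite (FE T0 T) // -mulrA weight_sqr // mulr1.
exists 0 => T Tk; rewrite mul0r F0 //; apply/eqP.
by have:= w0 T; rewrite Tk eqxx negbK.
Qed.
End Symmetry.

(** * Representatives of residues modulo n *)

Section Zn.
Variable n : nat.
Hypothesis n_gt1 : (1 < n)%N.

Lemma ltn_Zn (d : 'Z_n) : (d < n)%N.
Proof. by have := ltn_ord d; rewrite {2}Zp_cast. Qed.

Lemma val_Zn_nat m : (m < n)%N -> (m%:R : 'Z_n) = m :> nat.
Proof. by move=> ltmn; rewrite val_Zp_nat // modn_small. Qed.

Lemma val_subZn (z d : 'Z_n) : (z - d : 'Z_n) = (if d <= z then z - d else z + n - d)%N :> nat.
Proof.
have := ltn_Zn d; have := ltn_Zn z => ltz ltd.
have e : z - d = (if d <= z then z - d else z + n - d)%N%:R.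
  apply/eqP; rewrite subr_eq -[X in _ + X]natr_Zp -natrD -{1}[z]natr_Zp.
  case: ifP => le_dz; first by rewrite subnK.
  by rewrite subnK ?natrD ?pchar_Zp ?addr0 //; lia.
by rewrite {1}e val_Zn_nat //; case: ifP; lia.
Qed.

Lemma sum_Zn (V : nmodType) (F : nat -> V) : \sum_(z : 'Z_n) F z = \sum_(0 <= z < n) F z.
Proof. by rewrite -[in RHS](Zp_cast n_gt1) big_mkord. Qed.

Lemma Zn_two_neq0 : (2 < n)%N -> (1 + 1 : 'Z_n) != 0.
Proof.
move=> n_gt2; rewrite -[1 + 1]/(2%:R); apply/eqP=> /(congr1 (@nat_of_ord _)).
by rewrite val_Zn_nat.
Qed.

End Zn.

(** * Arcs of a cycle *)

Section Arcs.
Variables (n k : nat).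
Hypotheses (k_ge2 : (2 <= k)%N) (lt_2k_n : (2 * k < n)%N).
Implicit Types (x y z : 'Z_n).

(** Two arcs of length [k] whose starting points are [d] apart meet in [k - d]
    points at one end and in [k - (n - d)] points at the other; for [2 * k < n] at
    most one of these truncated differences is nonzero. *)
Definition overlap (d : nat) : nat := ((k - d) + (k - (n - d)))%N.

(** Overlap [k] occurs at distance [0], each intermediate overlap once on either
    side of it, and overlap [0] at the [n - 2 * k + 1] distances from [k] to
    [n - k]. *)
Lemma sum_overlap (V : nmodType) (H : nat -> V) :
  \sum_(0 <= d < n) H (overlap d)
  = H k + (\sum_(1 <= j < k) H j) *+ 2 + H 0%N *+ (n - 2 * k + 1).
Proof.
have ovl d : (d < k)%N -> overlap d = (k - d)%N by rewrite /overlap; lia.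
have ovr j : (j < k)%N -> overlap (n - k + j) = j by rewrite /overlap; lia.
have ov0 d : (k <= d)%N -> (d <= n - k)%N -> overlap d = 0%N by rewrite /overlap; lia.
rewrite (@big_cat_nat _ _ _ k) ?(@big_cat_nat _ _ _ (n - k).+1 k n) //=; try lia.
have -> : \sum_(0 <= d < k) H (overlap d) = H k + \sum_(1 <= j < k) H j.
  rewrite -{1}(prednK (ltnW k_ge2)) big_nat_recl // big_nat_rev big_add1 ovl ?subn0; last lia.
  by congr (_ + _); apply: eq_big_nat => j ltj; rewrite ovl; [congr (H _); lia | lia].
have -> : \sum_(k <= d < (n - k).+1) H (overlap d) = H 0%N *+ (n - 2 * k + 1).
  rewrite (eq_big_nat _ _ (F2 := fun=> H 0%N)) => [|d led]; last by rewrite ov0 //; lia.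
  by rewrite sumr_const_nat; congr (_ *+ _); lia.
have -> : \sum_((n - k).+1 <= d < n) H (overlap d) = \sum_(1 <= j < k) H j.
  have -> : \sum_(1 <= j < k) H j = \sum_(1 + (n - k) <= d < k + (n - k)) H (d - (n - k))%N.
    by rewrite big_addn addnK; apply: eq_bigr => j _; rewrite addnK.
  rewrite add1n subnKC; last lia.
  by apply: eq_big_nat => d led; rewrite -[d in LHS](@subnKC (n - k)) ?ovr ?addKn //; lia.
by rewrite mulr2n -!addrA; do 2![congr (_ + _)]; rewrite addrC.
Qed.

Definition arc x : {set 'Z_n} := [set z : 'Z_n | ((z - x)%R < k)%N].

Let n_gt1 : (1 < n)%N. Proof. by move: lt_2k_n; lia. Qed.

Lemma arc_shift c x z : (c + z \in arc (c + x)) = (z \in arc x).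
Proof. by rewrite !inE opprD addrACA subrr add0r. Qed.

Lemma sum_nat_interval a b m : (b <= m)%N -> (\sum_(0 <= z < m) (a <= z < b) = b - a)%N.
Proof.
move=> le_bm; have -> : (b - a = minn b m - a)%N by lia.
elim: m {le_bm} => [|m IHm]; first by rewrite big_nil; lia.
by rewrite big_nat_recr //= IHm; lia.
Qed.

Lemma card_arcI0 (d : 'Z_n) : #|arc 0 :&: arc d| = overlap d.
Proof.
rewrite -sum1_card big_mkcond /=.
have := ltn_Zn n_gt1 d => ltd.
transitivity (\sum_(z : 'Z_n) ((d <= z < k) + (0 <= z < k - (n - d))))%N.
  apply: eq_bigr => z _; rewrite !inE subr0 val_subZn //; have := ltn_Zn n_gt1 z.
  by case: (leqP d z) => le_dz; case: ifP; lia.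
rewrite (@sum_Zn _ n_gt1 nat (fun z : nat => (d <= z < k) + (0 <= z < k - (n - d)))%N) big_split /=.
have /= -> := @sum_nat_interval 0 (k - (n - d)) n; last lia.
by rewrite sum_nat_interval ?subn0 //; lia.
Qed.

Lemma card_arcI x y : #|arc x :&: arc y| = overlap (y - x)%R.
Proof.
rewrite -card_arcI0 -[RHS](card_imset _ (addrI x)); apply: eq_card => z.
rewrite -[z](subrKC x) mem_imset; last exact: addrI.
rewrite !in_setI -[in RHS](arc_shift x 0) addr0.
by rewrite -[in RHS](arc_shift x (y - x)) [x + (y - x)]subrKC.
Qed.

Lemma card_arc x : #|arc x| = k.
Proof. by rewrite -[arc x]setIid card_arcI subrr /overlap -[nat_of_ord 0]/0%N; lia. Qed.

Lemma arc_inj : injective arc.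
Proof.
move=> x y eq_xy; have := card_arcI x y; rewrite -eq_xy setIid card_arc.
have := ltn_Zn n_gt1 (y - x); rewrite /overlap => lt_d e.
have d0 : nat_of_ord (y - x) = 0%N by lia.
by apply/esym/eqP; rewrite -subr_eq0; apply/eqP/val_inj.
Qed.

(** Coprimality makes [i |-> (i - 1) * k + 1] a bijection of [Z_n], so that the
    blocks start at every point. *)
Lemma wreathE (pi : {perm 'Z_n}) : coprime n k ->
  wreath k pi = [set pi @: arc x | x : 'Z_n].
Proof.
move=> co_nk; have Uk : (k%:R : 'Z_n) \is a GRing.unit by rewrite unitZpE.
have blockE i : wreath_block k pi i = pi @: arc ((i - 1) * k%:R + 1).
  apply/setP=> z; apply/imsetP/imsetP => [[j _ ->] | [y]].
    exists ((i - 1) * k%:R + j.+1%:R) => //.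
    rewrite inE opprD addrACA subrr add0r -[1]/(1%:R) -natrB // subn1 /=.
    by rewrite val_Zn_nat //; have := ltn_ord j; lia.
  rewrite inE => ltk ->; exists (Ordinal ltk) => //; congr (pi _).
  rewrite -[nat_of_ord (Ordinal _)]/(nat_of_ord (y - ((i - 1) * k%:R + 1))).
  by rewrite mulrS natr_Zp; ring.
apply/setP=> T; apply/imsetP/imsetP => [[i _ ->] | [x _ ->]].
  by rewrite blockE; exists ((i - 1) * k%:R + 1).
exists ((x - 1) / k%:R + 1) => //; rewrite blockE addrK divrK //.
by rewrite subrK.
Qed.
End Arcs.

(** * The number of wreaths *)

Lemma wreathM n k (pi g : {perm 'Z_n}) :
  wreath k (pi * g) = [set g @: (T : {set 'Z_n}) | T in wreath k pi].
Proof.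
rewrite /wreath -imset_comp; apply: eq_imset => i /=.
by rewrite /wreath_block -imset_comp; apply: eq_imset => j; rewrite permM.
Qed.

Lemma wreath_imset n k (g : {perm 'Z_n}) :
  wreath k g = [set g @: (T : {set 'Z_n}) | T in wreath k 1].
Proof. by rewrite -wreathM mul1g. Qed.

Section Dihedral.
Variables (n k : nat).
Hypotheses (k_ge2 : (2 <= k)%N) (lt_2k_n : (2 * k < n)%N) (co_nk : coprime n k).
Implicit Types (x y z c : 'Z_n) (pi : {perm 'Z_n}).

Let n_gt1 : (1 < n)%N. Proof. lia. Qed.

Lemma wreath1E : wreath k 1 = [set arc k x | x : 'Z_n].
Proof.
rewrite wreathE //; apply: eq_imset => x; rewrite -[RHS]imset_id.
by apply: eq_imset => z; rewrite perm1.
Qed.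

(** The arcs through [x] and [y] start at the points [x - w] with [w] in the arcs
    starting at [0] and at [x - y]. So the family of arcs determines the distance
    of two points up to the ambiguity of [overlap]; in particular it determines
    adjacency, see [overlap_pred]. *)
Lemma codegree x y :
  #|[set T in wreath k 1 | (x \in T) && (y \in T)]| = overlap n k (x - y)%R.
Proof.
rewrite wreath1E -(card_arcI0 k_ge2 lt_2k_n).
have xB_inj : injective (fun z => x - z) by move=> z z' /addrI/oppr_inj.
rewrite -(card_imset _ (inj_comp (@arc_inj _ _ k_ge2 lt_2k_n) xB_inj)).
have flip z w : y - (x - w) = w - (x - y) by ring.
apply: eq_card => T; apply/setIdP/imsetP=> [[/imsetP[z _ ->]]|[w]]; last first.
  case/setIP; rewrite !inE subr0 => w1 w2 ->; split; first exact: imset_f.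
  by rewrite !inE flip // subKr w1.
rewrite !inE => /andP[xz yz]; exists (x - z); last by rewrite /= subKr.
by rewrite !inE subr0 -flip // subKr xz.
Qed.

Lemma overlap_pred (d : nat) : (d < n)%N -> overlap n k d = k.-1 ->
  d = 1%N \/ d = n.-1.
Proof. rewrite /overlap; lia. Qed.

Lemma dihedral_inj (b : bool) c : injective (fun z => c + (if b then - z else z)).
Proof. by move=> z z' /addrI; case: b => // /oppr_inj. Qed.

Definition dihedral b c : {perm 'Z_n} := perm (@dihedral_inj b c).

Lemma dihedral_wreath b c : wreath k (dihedral b c) = wreath k 1.
Proof.
have cardW pi : #|wreath k pi| = n.
  rewrite wreath_imset card_imset; last exact/imset_inj/perm_inj.
  rewrite wreath1E card_imset; last exact: arc_inj.
  by rewrite card_ord Zp_cast.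
apply/eqP; rewrite eqEcard !cardW leqnn andbT wreath_imset; apply/subsetP.
move=> T' /imsetP[T]; rewrite !wreath1E => /imsetP[x _ ->] -> {T'}.
have cardJ : #|dihedral b c @: arc k x| = k.
  by rewrite card_imset ?card_arc //; apply: perm_inj.
pose y := if b then c - x - k.-1%:R else c + x.
apply/imsetP; exists y => //; apply/eqP; rewrite eqEcard cardJ card_arc // leqnn andbT.
apply/subsetP=> _ /imsetP[z xz ->]; rewrite permE /y.
case: b cardJ @y => _; last by rewrite arc_shift.
move: xz; rewrite !inE => xz.
have -> : c - z - (c - x - k.-1%:R) = k.-1%:R - (z - x) by ring.
rewrite val_subZn // val_Zn_nat //; last lia.
by case: ifP; lia.
Qed.

(** A stabilizing permutation preserves codegrees, hence adjacency on the cycle: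
    it moves by [1] or [-1] at each step, and by injectivity it cannot turn back,
    so it is a rotation or a reflection. *)
Lemma stab_wreath pi : wreath k pi = wreath k 1 ->
  exists b c, pi = dihedral b c.
Proof.
move=> stab_pi.
have ovJ x y : overlap n k (pi x - pi y)%R = overlap n k (x - y)%R.
  have inj_pi : injective (fun T : {set 'Z_n} => pi @: T) by apply/imset_inj/perm_inj.
  rewrite -!codegree -[RHS](card_imset _ inj_pi); apply: eq_card => T.
  apply/setIdP/imsetP => [[] | [T']].
    rewrite -{1}stab_pi wreath_imset => /imsetP[T' WT' ->].
    rewrite !mem_imset; [|exact: perm_inj|exact: perm_inj] => xyT'.
    by exists T' => //; rewrite inE WT'.
  rewrite inE => /andP[WT' xyT'] ->.
  rewrite !mem_imset; [|exact: perm_inj|exact: perm_inj].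
  by rewrite -stab_pi wreath_imset imset_f.
have val1 : nat_of_ord (1 : 'Z_n) = 1%N by rewrite -[1]/(1%:R) val_Zn_nat.
have valN1 : nat_of_ord (- 1 : 'Z_n) = n.-1.
  by rewrite -[- 1]add0r val_subZn // val1 /= add0n subn1.
have step x : pi (x + 1) = pi x + 1 \/ pi (x + 1) = pi x - 1.
  have := ovJ (x + 1) x; rewrite addrAC subrr add0r val1.
  rewrite [X in _ = X](_ : _ = k.-1); last by rewrite /overlap; lia.
  case/(overlap_pred (ltn_Zn n_gt1 _)) => e; [left | right]; apply/eqP.
    by rewrite [pi x + _]addrC -subr_eq; apply/eqP/ord_inj; rewrite e val1.
  by rewrite [pi x + _]addrC -subr_eq; apply/eqP/ord_inj; rewrite e valN1.
have nz2 : (1 + 1 : 'Z_n) != 0 by apply: Zn_two_neq0; lia.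
(* Turning back would give pi (x + 2) = pi x. *)
have same x (e : 'Z_n) : pi (x + 1) = pi x + e -> pi (x + 1 + 1) = pi (x + 1) + e.
  have neq : pi (x + 1 + 1) != pi x.
    by rewrite (inj_eq perm_inj) -addrA -subr_eq0 addrAC subrr add0r.
  case: (step x) => e1; case: (step (x + 1)) => e2; rewrite e2 e1 => /addrI <- //.
    by rewrite e2 e1 addrK eqxx in neq.
  by rewrite e2 e1 subrK eqxx in neq.
have pi_step e : pi (0 + 1) = pi 0 + e -> forall x, pi x = pi 0 + e * x.
  move=> e0 x; suff [] : pi (nat_of_ord x)%:R = pi 0 + e * (nat_of_ord x)%:R
      /\ pi ((nat_of_ord x)%:R + 1) = pi (nat_of_ord x)%:R + e by rewrite natr_Zp.
  elim: (nat_of_ord x) => [|m [IH1 IH2]]; first by rewrite mulr0 addr0.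
  rewrite -natr1; split; last exact: same.
  by rewrite IH2 IH1 mulrDr mulr1 addrA.
case: (step 0) => /pi_step piE.
  by exists false, (pi 0); apply/permP=> x; rewrite piE mul1r permE.
by exists true, (pi 0); apply/permP=> x; rewrite piE mulN1r permE.
Qed.

Lemma card_stab_wreath : #|[set pi : {perm 'Z_n} | wreath k pi == wreath k 1]| = (2 * n)%N.
Proof.
have inj_f : injective (fun p : bool * 'Z_n => dihedral p.1 p.2).
  move=> [b c] [b' c'] /= /permP e; have e0 := e 0; have e1 := e 1.
  rewrite !permE !oppr0 !if_same !addr0 in e0 e1.
  rewrite e0; congr (_, _); move: e1; rewrite e0 => /addrI.
  have nz2 : (1 + 1 : 'Z_n) != 0 by apply: Zn_two_neq0; lia.
  case: b {e}; case: b' => // /eqP.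
    by rewrite eq_sym -subr_eq0 opprK (negPf nz2).
  by rewrite -subr_eq0 opprK (negPf nz2).
have -> : (2 * n)%N = #|{: bool * 'Z_n}| by rewrite card_prod card_bool card_ord Zp_cast.
rewrite -(card_imset _ inj_f); apply: eq_card => pi; rewrite inE.
apply/eqP/imsetP => [/stab_wreath[b [c ->]] | [[b c] _ ->]]; first by exists (b, c).
exact: dihedral_wreath.
Qed.

(** Orbit-stabilizer for the wreath of the identity arrangement, whose stabilizer
    is dihedral of order [2 * n]. *)
Lemma card_wreaths : (#|wreaths n k| * (2 * n) = n`!)%N.
Proof.
have def_W : wreaths n k = orbit 'P^*^* [set: {perm 'Z_n}] (wreath k 1).
  apply/setP=> F; apply/imsetP/orbitP => [[pi _ ->] | [pi _ <-]]; exists pi; rewrite ?inE //.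
    by rewrite (wreath_imset k pi).
  by rewrite (wreath_imset k pi).
rewrite -card_stab_wreath def_W.
transitivity #|[set: {perm 'Z_n}]|; last by rewrite cardsT card_Sn Zp_cast.
rewrite -(card_orbit_stab 'P^*^* _ (wreath k 1)); congr (_ * _)%N.
apply: eq_card => pi; rewrite !inE /= sub1set inE /=.
by rewrite (wreath_imset k pi).
Qed.
End Dihedral.

(** * Pair weights in the permutation module of k-subsets *)

Section RowVectors.
Variables (C : numFieldType) (n k : nat).
Local Notation rG := (ksubset_repr C n k).
Local Notation ksub := (ksubsets n k).
Implicit Types (T : {set 'Z_n}) (g : {perm 'Z_n}) (x y : 'Z_n).
Implicit Types (ps : seq ('Z_n * 'Z_n)) (i j : 'I_#|ksub|).

Lemma ksubset_index g : exists2 s : 'I_#|ksub| -> 'I_#|ksub|,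
  injective s & forall i, enum_val (s i) = g @: enum_val i.
Proof.
have gT (i : 'I_#|ksub|) : g @: enum_val i \in ksub.
  have := enum_valP i; rewrite !inE card_imset //; exact: perm_inj.
pose s (i : 'I_#|ksub|) := enum_rank_in (enum_valP i) (g @: enum_val i).
have sE i : enum_val (s i) = g @: enum_val i by rewrite enum_rankK_in.
exists s => // i j eq_s; apply: enum_val_inj.
by apply: (imset_inj (@perm_inj _ g)); rewrite -!sE eq_s.
Qed.

Lemma wreath_index g : exists2 r : 'I_#|wreaths n k| -> 'I_#|wreaths n k|,
  injective r & forall f, enum_val (r f) = [set g @: (T : {set 'Z_n}) | T in enum_val f].
Proof.
have gF (f : 'I_#|wreaths n k|) :
    [set g @: (T : {set 'Z_n}) | T in enum_val f] \in wreaths n k.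
  have /imsetP[pi _ ->] := enum_valP f; rewrite -wreathM; exact: imset_f.
pose r (f : 'I_#|wreaths n k|) :=
  enum_rank_in (enum_valP f) [set g @: (T : {set 'Z_n}) | T in enum_val f].
have rE f : enum_val (r f) = [set g @: (T : {set 'Z_n}) | T in enum_val f].
  by rewrite enum_rankK_in.
exists r => // i j eq_r; apply: enum_val_inj.
by apply: (imset_inj (imset_inj (@perm_inj _ g))); rewrite -!rE eq_r.
Qed.

Lemma ksubset_reprE (u : 'rV[C]_#|ksub|) g i j :
  enum_val j = g @: enum_val i -> (u *m rG g) 0 j = u 0 i.
Proof.
move=> def_j; rewrite mxE (bigD1 i) //= big1 ?addr0 => [|m ne_mi]; rewrite mxE.
  by rewrite def_j eqxx mulr1.
rewrite def_j (inj_eq (imset_inj (@perm_inj _ g))) (inj_eq enum_val_inj).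
by rewrite (negPf ne_mi) mulr0.
Qed.

Definition weight_row ps : 'rV[C]_#|ksub| := \row_j weight C ps (enum_val j).

Lemma row_action (u v : 'rV[C]_#|ksub|) g :
  (forall i j, enum_val j = g @: enum_val i -> v 0 j = u 0 i) -> u *m rG g = v.
Proof.
have [s s_inj sE] := ksubset_index g => uv; apply/rowP=> j.
have [s' _ s'K] := injF_bij s_inj.
by rewrite -[j]s'K (ksubset_reprE _ (sE _)) (uv _ _ (sE _)).
Qed.

Lemma weight_rowM ps g : weight_row ps *m rG g = weight_row (map_pairs g ps).
Proof. by apply: row_action => i j def_j; rewrite !mxE def_j weight_map_pairs. Qed.

Lemma weight_row_flip p ps : uniq (points ps) -> p \in ps ->
  weight_row ps *m rG (tperm p.1 p.2) = - weight_row ps.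
Proof.
by move=> Ups pps; apply: row_action => i j def_j; rewrite !mxE def_j weight_flip ?opprK.
Qed.

Lemma weight_row_fix x y ps : x \notin points ps -> y \notin points ps ->
  weight_row ps *m rG (tperm x y) = weight_row ps.
Proof.
by move=> xps yps; apply: row_action => i j def_j; rewrite !mxE def_j weight_fix.
Qed.

Lemma weight_row_unique ps (u : 'rV[C]_#|ksub|) : uniq (points ps) ->
  {in ps, forall p, u *m rG (tperm p.1 p.2) = - u} ->
  (forall x y, x \notin points ps -> y \notin points ps -> u *m rG (tperm x y) = u) ->
  exists c, u = c *: weight_row ps.
Proof.
move=> Ups u_flip u_fix; pose F T := \sum_(i | enum_val i == T) u 0 i.
have FE i : F (enum_val i) = u 0 i.
  rewrite /F (bigD1 i) //= big1 ?addr0 // => j /andP[/eqP/enum_val_inj-> /eqP//].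
have FJ g T e : u *m rG g = e *: u -> #|T| = k -> e * F (g @: T) = F T.
  move=> ug Tk; have [s _ sE] := ksubset_index g.
  have Tksub : T \in ksub by rewrite inE Tk.
  rewrite -(enum_rankK_in Tksub Tksub) -sE !FE.
  by rewrite -[RHS](ksubset_reprE u (sE _)) ug mxE.
have [||c Fc] := @weight_unique _ C k ps F Ups.
- move=> p T pps Tk; rewrite -(FJ (tperm p.1 p.2) T (- 1)) // ?mulN1r ?opprK //.
  by rewrite u_flip // scaleN1r.
- move=> x y T xps yps Tk; rewrite -[LHS]mul1r; apply: FJ => //.
  by rewrite scale1r u_fix.
exists c; apply/rowP=> i; rewrite !mxE -FE Fc //.
by apply/eqP; have := enum_valP i; rewrite inE.
Qed.

(** Its entry at [T, T'] is the number of wreaths that contain both. *)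
Definition codeg_mx : 'M[C]_#|ksub| := Phi C n k *m (Phi C n k)^T.

Lemma codeg_mx_commutes (u : 'rV[C]_#|ksub|) g :
  u *m codeg_mx *m rG g = u *m rG g *m codeg_mx.
Proof.
have [s s_inj sE] := ksubset_index g.
have [s' _ s'K] := injF_bij s_inj.
apply/rowP=> j; rewrite -[j]s'K (ksubset_reprE _ (sE _)); move: (s' j) => i.
rewrite [LHS]mxE [RHS]mxE [RHS](reindex_inj s_inj) /=; apply: eq_bigr => m _.
rewrite (ksubset_reprE _ (sE _)); congr (_ * _); rewrite !mxE.
have [r r_inj rE] := wreath_index g.
rewrite [RHS](reindex_inj r_inj); apply: eq_bigr => f _; rewrite !mxE !sE !rE.
by rewrite !(mem_imset _ _ (imset_inj (@perm_inj _ g))).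
Qed.
End RowVectors.

(** * The eigenvalue as a sum over arcs *)

Section Eigenvalue.
Variables (C : numFieldType) (n k : nat).
Hypotheses (k_ge2 : (2 <= k)%N) (lt_2k_n : (2 * k < n)%N) (co_nk : coprime n k).
Local Notation ksub := (ksubsets n k).
Implicit Types (T : {set 'Z_n}) (x y : 'Z_n) (ps : seq ('Z_n * 'Z_n)).

Let n_gt1 : (1 < n)%N. Proof. by move: lt_2k_n; lia. Qed.

Let card_Zn : #|'Z_n| = n. Proof. by rewrite card_ord Zp_cast. Qed.

(** The image of a weight vector has the same symmetries, so it is a multiple of
    that vector; the factor does not depend on the pairs because permutations act
    transitively on lists of disjoint pairs. *)
Lemma weight_row_eigen ps0 : uniq (points ps0) ->
  exists a, forall ps, uniq (points ps) -> size ps = size ps0 ->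
    weight_row C k ps *m codeg_mx C n k = a *: weight_row C k ps.
Proof.
move=> Ups0; have [|x y xps yps|a def_a] := @weight_row_unique C n k ps0
  (weight_row C k ps0 *m codeg_mx C n k) Ups0.
- by move=> p pps; rewrite codeg_mx_commutes weight_row_flip // mulNmx.
- by rewrite codeg_mx_commutes weight_row_fix.
exists a => ps Ups /esym eq_size; have [g <-] := map_pairs_exists Ups0 Ups eq_size.
by rewrite -weight_rowM -codeg_mx_commutes def_a scalemxAl.
Qed.

Lemma sum_weight_norm l :
  \sum_(ps <- pairings l [set: 'Z_n]) (weight_row C k ps *m (weight_row C k ps)^T) 0 0
  = ('C(n, k) * (k ^_ l * (n - k) ^_ l))%:R * 2 ^+ l.
Proof.
under eq_bigr do rewrite mxE.
rewrite exchange_big /= (eq_bigr (fun=> (k ^_ l * (n - k) ^_ l)%:R * 2 ^+ l)).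
  rewrite sumr_const card_ord -[LHS]mulr_natl [in RHS]natrM -[in RHS]mulrA; congr (_%:R * _).
  rewrite -[in RHS]card_Zn -card_draws /ksubsets.
  by apply: eq_card => T; rewrite !inE.
move=> i _; under eq_bigr do rewrite !mxE.
have Tk : #|enum_val i| = k by apply/eqP; have := enum_valP i; rewrite inE.
rewrite sum_weight /cross_sets !setTI setIid setUid setDv cards0 Tk cross_diag mulrC.
by rewrite cardsCs setCK Tk card_Zn.
Qed.

Lemma wreath_ksubset (f : 'I_#|wreaths n k|) T : T \in enum_val f -> T \in ksub.
Proof.
have /imsetP[pi _ ->] := enum_valP f; rewrite wreathE // => /imsetP[x _ ->].
by rewrite inE card_imset ?card_arc ?eqxx //; apply: perm_inj.
Qed.

(** The sum on the left ranges over [k]-subsets and the one on the right over all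
    blocks of the wreath, which are [k]-subsets by [wreath_ksubset]. *)
Lemma weight_row_Phi ps f : (weight_row C k ps *m Phi C n k) 0 f
  = \sum_(T in enum_val f) weight C ps T.
Proof.
rewrite mxE; under eq_bigr do rewrite !mxE.
rewrite -(big_enum_val (fun T => weight C ps T * (T \in enum_val f)%:R)) /=.
rewrite [RHS]big_mkcond [LHS]big_mkcond; apply: eq_bigr => T _ /=.
have := @wreath_ksubset f T; case: (T \in enum_val f) => [-> // | _].
  by rewrite mulr1.
by rewrite mulr0 if_same.
Qed.

Lemma wreath_mx_Phi : wreath_mx C n k = (Phi C n k)^T *m Phi C n k.
Proof.
apply/matrixP=> f f'; rewrite !mxE; under eq_bigr do rewrite !mxE -natrM mulnb.
rewrite -(big_enum_val (fun T => ((T \in enum_val f) && (T \in enum_val f'))%:R)) /=.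
rewrite -natr_sum -sum1_card; congr (_%:R).
rewrite [LHS]big_mkcond [RHS]big_mkcond; apply: eq_bigr => T _ /=; rewrite inE.
have := @wreath_ksubset f T; case: (T \in enum_val f) => [-> // | _].
by rewrite if_same.
Qed.

(** The correlation of two [k]-subsets that share [j] points, up to [2 ^+ l]. *)
Definition overlap_cross l (j : nat) : C :=
  cross C l j (k - j) (k - j) (n - 2 * k + j).

Lemma cross_sets_ksubsets l T T' : #|T| = k -> #|T'| = k ->
  cross_sets C l [set: 'Z_n] T T' = overlap_cross l #|T :&: T'|.
Proof.
move=> Tk T'k; rewrite /cross_sets !setTI !cardsD [T' :&: T]setIC Tk T'k.
congr (cross _ _ _ _ _ _); rewrite cardsCs setCK cardsU card_Zn Tk T'k.
have := subset_leq_card (subsetIl T T'); have := max_card T; rewrite card_Zn Tk; lia.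
Qed.

(** Since [N = Phi Phi^T], the quadratic form at a weight vector is the sum, over
    the wreaths, of the squared sum of the weights of the blocks. After exchanging
    sums each wreath contributes the correlations of all pairs of its arcs. *)
Lemma sum_weight_wreaths l :
  \sum_(ps <- pairings l [set: 'Z_n])
     (weight_row C k ps *m codeg_mx C n k *m (weight_row C k ps)^T) 0 0
  = (#|wreaths n k| * n)%:R * 2 ^+ l * \sum_(0 <= d < n) overlap_cross l (overlap n k d).
Proof.
have quad ps : (weight_row C k ps *m codeg_mx C n k *m (weight_row C k ps)^T) 0 0
    = \sum_(f < #|wreaths n k|) \sum_(T in enum_val f) \sum_(T' in enum_val f)
        weight C ps T * weight C ps T'.
  rewrite /codeg_mx mulmxA -mulmxA -trmx_mul mxE; apply: eq_bigr => f _.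
  by rewrite [X in _ * X]mxE weight_row_Phi big_distrlr.
rewrite (eq_bigr _ (fun ps _ => quad ps)) exchange_big /=.
rewrite (eq_bigr (fun=> n%:R * 2 ^+ l * \sum_(0 <= d < n) overlap_cross l (overlap n k d))).
  by rewrite sumr_const card_ord -[LHS]mulr_natl natrM !mulrA.
move=> f _; have /imsetP[pi _ ->] := enum_valP f.
have pi_inj : injective (fun T => pi @: T) by apply/imset_inj/perm_inj.
have arcs_inj : injective (fun x => pi @: arc k x).
  by move=> x y /pi_inj/arc_inj; apply.
rewrite exchange_big /=; under eq_bigr do rewrite exchange_big /=.
rewrite wreathE // big_imset /=; last exact: in2W.
transitivity (\sum_(x : 'Z_n) 2 ^+ l * \sum_(y : 'Z_n) overlap_cross l (overlap n k y)).
  apply: eq_bigr => x _; rewrite big_imset /=; last exact: in2W.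
  rewrite mulr_sumr (reindex_inj (addIr x)) /=; apply: eq_bigr => y _.
  rewrite sum_weight cross_sets_ksubsets.
  - rewrite -imsetI; last by move=> z z' _ _; apply: perm_inj.
    by rewrite card_imset ?card_arcI ?addrK //; apply: perm_inj.
  - by rewrite card_imset ?card_arc //; apply: perm_inj.
  - by rewrite card_imset ?card_arc //; apply: perm_inj.
rewrite sumr_const card_Zn -[LHS]mulr_natl mulrA.
by rewrite (sum_Zn n_gt1 (fun d => overlap_cross l (overlap n k d))).
Qed.

(** Compare [sum_weight_wreaths] with [a] times [sum_weight_norm]; the number
    [n! / (2 * n)] of wreaths and ['C(n, k)] combine to the factorials. *)
Lemma eigenvalueE l a : (l <= k)%N ->
  (forall ps, uniq (points ps) -> size ps = l ->
    weight_row C k ps *m codeg_mx C n k = a *: weight_row C k ps) ->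
  a = ((k - l)`! * (n - k - l)`!)%:R / 2
      * \sum_(0 <= d < n) overlap_cross l (overlap n k d).
Proof.
move=> le_lk eigen; set G := \sum_(0 <= d < n) _.
have nz_nat m : (0 < m)%N -> m%:R != 0 :> C by rewrite pnatr_eq0 -lt0n.
have: a * ('C(n, k) * (k ^_ l * (n - k) ^_ l))%:R = (#|wreaths n k| * n)%:R * G.
  apply: (@mulIf _ (2 ^+ l)); first by rewrite expf_neq0 ?nz_nat.
  rewrite -mulrA -sum_weight_norm mulrAC -sum_weight_wreaths mulr_sumr.
  rewrite [in RHS]big_seq [in LHS]big_seq; apply: eq_bigr => ps /pairingsP[psl Ups _].
  by rewrite eigen // -scalemxAl [RHS]mxE.
move/(congr1 (fun b => b * ((k - l)`! * (n - k - l)`! * 2)%:R)).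
have -> : a * ('C(n, k) * (k ^_ l * (n - k) ^_ l))%:R * ((k - l)`! * (n - k - l)`! * 2)%:R
   = a * 2 * (n`!)%:R.
  rewrite -(@bin_fact n k); last lia.
  rewrite -(ffact_fact le_lk) -(@ffact_fact (n - k) l); last lia.
  by rewrite !natrM; ring.
have -> : (#|wreaths n k| * n)%:R * G * ((k - l)`! * (n - k - l)`! * 2)%:R
   = ((k - l)`! * (n - k - l)`!)%:R * G * (n`!)%:R.
  by rewrite -(card_wreaths k_ge2 lt_2k_n co_nk) !natrM; ring.
move/(mulIf (nz_nat _ (fact_gt0 n))) => e.
by rewrite mulrAC -e mulfK ?nz_nat.
Qed.
End Eigenvalue.

(** * Copies of a two-row Specht module *)

(** A similarity of the two submodules, written in coordinates of the ambient
    spaces: this avoids carrying the coordinates of [submod_repr] further. *)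
Lemma rsim_intertwiner (F : fieldType) (gT : finGroupType) (G : {group gT}) n1 n2
    (rG1 : mx_representation F G n1) (rG2 : mx_representation F G n2)
    (U : 'M_n1) (V : 'M_n2) (modU : mxmodule rG1 U) (modV : mxmodule rG2 V) :
  mx_rsim (submod_repr modU) (submod_repr modV) ->
  exists h : 'M_(n1, n2),
    [/\ (U *m h :=: V)%MS,
        forall u : 'rV_n1, (u <= U)%MS -> u *m h = 0 -> u = 0
      & forall (u : 'rV_n1) x, (u <= U)%MS -> x \in G ->
          u *m rG1 x *m h = u *m h *m rG2 x].
Proof.
case=> B eq_rank B_free B_hom.
have /row_fullP[B' B'B] : row_full B.
  by move: B_free; rewrite /row_full => /eqP->; apply/eqP.
exists (in_submod U 1%:M *m B *m row_base V).
have hE m (W : 'M_(m, n1)) : W *m (in_submod U 1%:M *m B *m row_base V)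
    = val_submod (in_submod U W *m B).
  by rewrite -[RHS]/(in_submod U W *m B *m row_base V) [in_submod U W]in_submodE !mulmxA.
split=> [|u uU|u x uU Gx].
- apply/eqmxP; rewrite hE val_submodP /=.
  rewrite -(eq_row_base V) -[X in (X <= _)%MS]mul1mx -[_ *m _]/(val_submod 1%:M).
  by rewrite -B'B -[B' in B' *m B](@val_submodK _ _ U) -!hE submxMr ?val_submodP.
- move/eqP; rewrite hE val_submod_eq0 => /eqP uB0.
  by rewrite -(in_submodK uU) (row_free_inj B_free (etrans uB0 (esym (mul0mx _ B)))) linear0.
- by rewrite !hE in_submodJ // -mulmxA B_hom // mulmxA val_submodJ.
Qed.

Section TwoRowPolytabloid.
Variables (C : fieldType) (n l : nat).
Hypotheses (n_gt1 : (1 < n)%N) (le_2l_n : (2 * l <= n)%N).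
Local Notation sh := [:: n - l; l]%N.
Local Notation rT := (tabloid_repr C n sh).
Local Notation e1 := (polytabloid C (n := n) sh 1).
Implicit Types (x y : 'Z_n) (s g : {perm 'Z_n}).

(** The columns of length two of the tableau [1] of shape [(n - l, l)]. *)
Definition column_pairs : seq ('Z_n * 'Z_n) :=
  [seq (i%:R, (n - l + i)%:R) | i <- iota 0 l].

Lemma val_column_points :
  [seq nat_of_ord x | x <- points column_pairs] = iota 0 l ++ iota (n - l) l.
Proof.
have lt_n i : i \in iota 0 l -> (i < n)%N /\ (n - l + i < n)%N.
  by rewrite mem_iota; lia.
rewrite /points map_cat /unzip1 /unzip2 -!map_comp -[in RHS](addn0 (n - l)%N) iotaDl.
congr (_ ++ _); last first.
  by apply/eq_in_map => i /lt_n[_ lti] /=; rewrite val_Zn_nat.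
rewrite -[RHS]map_id; apply/eq_in_map => i /lt_n[lti _] /=.
by rewrite val_Zn_nat.
Qed.

Lemma uniq_column_points : uniq (points column_pairs).
Proof.
apply: (map_uniq (f := @nat_of_ord _)); rewrite val_column_points cat_uniq !iota_uniq andbT.
by apply/hasPn=> i; rewrite !mem_iota; lia.
Qed.

Lemma mem_column_points x : (x \in points column_pairs) = (x < l)%N || (n - l <= x)%N.
Proof.
rewrite -(mem_map (@ord_inj _)) val_column_points mem_cat !mem_iota.
by have := ltn_Zn n_gt1 x; lia.
Qed.

Lemma cell_of x : reshape_index sh x = (n - l <= x)%N /\
  reshape_offset sh x = (if x < n - l then nat_of_ord x else x - (n - l))%N.
Proof.
have ltx := ltn_Zn n_gt1 x; case: ltnP => [lt_x | le_x].
  by split; [exact: (@flatten_indexKl sh 0) | exact: (@flatten_indexKr sh 0)].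
have def_x : nat_of_ord x = flatten_index sh 1 (x - (n - l)).
  by rewrite /flatten_index /= addn0 subnKC.
have lt_l : (x - (n - l) < nth 0 sh 1)%N by rewrite /=; lia.
by rewrite def_x flatten_indexKl // flatten_indexKr // -def_x.
Qed.

Lemma column_of1 x : column_of sh 1 x = (if x < n - l then nat_of_ord x else x - (n - l))%N.
Proof. by rewrite /column_of invg1 perm1; case: (cell_of x). Qed.

Lemma row_of1 x : row_of sh 1 x = (n - l <= x)%N.
Proof. by rewrite /row_of invg1 perm1; case: (cell_of x). Qed.

Lemma cell_inj x y : column_of sh 1 x = column_of sh 1 y ->
  row_of sh 1 x = row_of sh 1 y -> x = y.
Proof.
rewrite /column_of /row_of invg1 !perm1 => eq_col eq_row; apply: ord_inj.
by rewrite -(reshape_indexK sh x) eq_col eq_row reshape_indexK.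
Qed.

Lemma column_stab1P s : reflect (forall x, column_of sh 1 (s x) = column_of sh 1 x)
  (s \in column_stabilizer sh 1).
Proof. by rewrite inE; apply: (iffP forallP) => H x; apply/eqP. Qed.

(** The sum defining the polytabloid runs over the column group, so
    multiplying by [g] only reindexes it, up to the sign of [g]. *)
Lemma polytabloid_column g : g \in column_stabilizer sh 1 ->
  e1 *m rT g = (-1) ^+ g *: e1.
Proof.
move=> /column_stab1P colg; rewrite mulmx_suml scaler_sumr.
rewrite [RHS](reindex_inj (mulIg g)) /=; apply: eq_big => [s | s _].
  apply/column_stab1P/column_stab1P => cols x.
    by rewrite permM colg.
  by rewrite -colg -permM.
by rewrite -scalemxAl tabloid_vectorM scalerA odd_permM signr_addb mulrC -mulrA
  -signr_addb addbb mulr1 mulgA.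
Qed.

Lemma polytabloid_flip p : p \in column_pairs ->
  e1 *m rT (tperm p.1 p.2) = - e1.
Proof.
case/mapP=> i; rewrite mem_iota add0n => /andP[_ lt_il] -> /=.
have v1 : nat_of_ord (i%:R : 'Z_n) = i by rewrite val_Zn_nat //; lia.
have v2 : nat_of_ord ((n - l + i)%:R : 'Z_n) = (n - l + i)%N by rewrite val_Zn_nat //; lia.
have eq_col : column_of sh 1 (i%:R : 'Z_n) = column_of sh 1 ((n - l + i)%:R : 'Z_n).
  by rewrite !column_of1 v1 v2; do 2![case: ifP]; lia.
rewrite polytabloid_column; last first.
  by apply/column_stab1P => x; case: tpermP => [->|->|].
rewrite odd_tperm; case: eqP => [eq_p | _]; last by rewrite expr1 scaleN1r.
by move: v2; rewrite -eq_p v1; lia.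
Qed.

(** A point outside [column_pairs] is alone in its column, so every [s] in the
    column group fixes [x] and [y] and commutes with their transposition, which
    preserves the tabloid of [1] because both points lie in its first row. *)
Lemma polytabloid_fix x y : x \notin points column_pairs -> y \notin points column_pairs ->
  e1 *m rT (tperm x y) = e1.
Proof.
rewrite !mem_column_points !negb_or -!leqNgt -!ltnNge => x_free y_free.
have fixed s (z : 'Z_n) : s \in column_stabilizer sh 1 -> (l <= z < n - l)%N -> s z = z.
  move=> /column_stab1P/(_ z); rewrite !column_of1 => eq_col z_free; apply: ord_inj.
  by move: eq_col (ltn_Zn n_gt1 (s z)); do 2![case: ifP]; lia.
rewrite mulmx_suml; apply: eq_bigr => s col_s.
rewrite -scalemxAl tabloid_vectorM; congr (_ *: tabloid_vector _ _ _).
have sgC : (s * tperm x y = tperm x y * s)%g.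
  by rewrite [RHS]conjgC tpermJ !fixed.
rewrite !mul1g sgC -tabloidM -[in RHS](mul1g s) -tabloidM; congr (_ :* s)%g.
apply/setP=> t; rewrite !inE; apply: eq_forallb => z; congr (_ == _).
have -> : row_of sh (tperm x y) z = row_of sh 1 (tperm x y z).
  by rewrite /row_of tpermV invg1 perm1.
by rewrite !row_of1; case: tpermP => [->|->|//]; move: x_free y_free; lia.
Qed.

(** The tabloid of [1] has coefficient [1]: a column permutation that also
    preserves rows is trivial. *)
Lemma polytabloid_neq0 : e1 != 0.
Proof.
have t1T : tabloid sh 1 \in tabloids n sh by apply: imset_f.
apply/eqP=> /rowP/(_ (enum_rank_in t1T (tabloid sh 1))); rewrite [RHS]mxE summxE.
rewrite (bigD1 1%g) /=; last by apply/column_stab1P => x; rewrite perm1.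
rewrite !mxE mulg1 enum_rankK_in // eqxx mulr1 odd_perm1 expr0 big1 ?addr0.
  by move/eqP; rewrite oner_eq0.
move=> s /andP[/column_stab1P col_s /eqP ne_s1]; rewrite !mxE enum_rankK_in // mul1g.
case: eqP => [eq_tab | _]; last by rewrite mulr0.
case: ne_s1; apply/permP=> x; rewrite perm1; apply: cell_inj => //.
have: s \in tabloid sh 1 by rewrite -eq_tab inE; apply/forallP.
rewrite inE => /forallP/(_ (s x))/eqP; rewrite {1}/row_of permK => <-.
by rewrite /row_of invg1 perm1.
Qed.

End TwoRowPolytabloid.

(** The polytabloid of the tableau [1] generates the Specht module, and its image
    in [U] has the symmetries of [weight_unique], hence is a nonzero multiple of a
    weight vector. *)
Lemma specht_submodule_weights (C : numFieldType) n k l (U : 'M[C]_#|ksubsets n k|) :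
  (1 < n)%N -> (2 * l <= n)%N -> is_specht_submodule l U ->
  (forall qs, uniq (points qs) -> size qs = l -> (weight_row C k qs <= U)%MS)
  /\ (U <= \sum_g <<weight_row C k (map_pairs g (column_pairs n l))>>)%MS.
Proof.
move=> n_gt1 le_2l_n [modU /mx_rsim_sym/rsim_intertwiner[h [def_U h_inj h_hom]]].
set ps := column_pairs n l; set e1 := polytabloid C (n := n) [:: n - l; l]%N 1.
have e1S : (e1 <= specht_mx C n [:: n - l; l]%N)%MS.
  by rewrite (sumsmx_sup 1%g) // genmxE.
have [|||c def_c] := @weight_row_unique C n k ps (e1 *m h).
- exact: uniq_column_points.
- by move=> p pps; rewrite -h_hom ?inE // polytabloid_flip // mulNmx.
- by move=> x y xps yps; rewrite -h_hom ?inE // polytabloid_fix.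
have nz_c : c != 0.
  have e1_neq0 : e1 != 0 by apply: polytabloid_neq0.
  apply: contra_neq e1_neq0 => c0.
  by apply: h_inj; rewrite // def_c c0 scale0r.
have weightE : weight_row C k ps = c^-1 *: (e1 *m h) by rewrite def_c scalerA mulVf ?scale1r.
split=> [qs Uqs size_qs|].
  have size_ps : size ps = size qs by rewrite size_qs size_map size_iota.
  have [g <-] := map_pairs_exists (uniq_column_points n_gt1 le_2l_n) Uqs size_ps.
  by rewrite -weight_rowM mxmodule_trans ?inE // weightE scalemx_sub // -def_U submxMr.
rewrite -def_U /specht_mx sumsmxMr_gen; apply/sumsmx_subP=> g _.
rewrite genmxE (eqmxMr _ (genmxE _)) (sumsmx_sup g) // genmxE -weight_rowM.
rewrite -[g in X in (X <= _)%MS]mul1g -polytabloidM h_hom ?inE // def_c -scalemxAl.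
exact: scalemx_sub.
Qed.

(** * The eigenspace is not killed by Phi *)

Section SeparatingArc.
Variables (C : numFieldType) (n k l : nat).
Hypotheses (lt_2k_n : (2 * k < n)%N) (l_ge2 : (2 <= l)%N) (le_lk : (l <= k)%N).
Hypothesis co_nk : coprime n k.

Let n_gt1 : (1 < n)%N. Proof. by move: lt_2k_n; lia. Qed.
Let k_ge2 : (2 <= k)%N. Proof. exact: leq_trans le_lk. Qed.

(** In the wreath of the identity arrangement, place [a_1], [b_1] at the positions
    [0], [n - 1], place [a_2], [b_2] at [k - 1], [k], the other [a_i] inside the arc
    from [0] to [k - 1] and the other [b_i] outside it. Besides this arc, the only arc to
    separate the first pair starts at [n - k] and the only one to separate the
    second starts at [k]; as [k < n - k], just one block contributes to the sum.
    This is where two pairs are needed, [2 <= l]. *)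
Lemma weight_row_Phi_neq0 : exists qs : seq ('Z_n * 'Z_n),
  [/\ uniq (points qs), size qs = l & weight_row C k qs *m Phi C n k != 0].
Proof.
(* The pairs as positions in 0, ..., n - 1. *)
pose ms : seq (nat * nat) := [:: (0, n.-1); (k.-1, k)] ++ [seq (i, k + i) | i <- iota 1 (l - 2)]%N.
pose qs : seq ('Z_n * 'Z_n) := [seq (p.1%:R, p.2%:R) | p <- ms].
have msP p : p \in ms -> (p.1 < k <= p.2)%N /\ (p.2 < n)%N.
  rewrite mem_cat !inE => /orP[/orP[] /eqP->|/mapP[i]] /=; try lia.
  by rewrite mem_iota => lti -> /=; lia.
have val_points : [seq nat_of_ord x | x <- points qs] = unzip1 ms ++ unzip2 ms.
  rewrite /points map_cat /unzip1 /unzip2 -!map_comp; congr (_ ++ _).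
    by apply/eq_in_map => p /msP /= [lep ltp]; rewrite val_Zn_nat //; lia.
  by apply/eq_in_map => p /msP /= [lep ltp]; rewrite val_Zn_nat //; lia.
exists qs; split.
- apply: (map_uniq (f := @nat_of_ord _)); rewrite val_points.
  rewrite /unzip1 /unzip2 !map_cat -!map_comp /= map_id.
  have -> : [seq snd (i, k + i)%N | i <- iota 1 (l - 2)] = iota k.+1 (l - 2).
    by rewrite -[k.+1]addn1 iotaDl.
  rewrite /= cat_uniq /= !inE !mem_cat !inE !mem_iota !iota_uniq.
  have -> : has [in iota 1 (l - 2)] (iota k.+1 (l - 2)) = false.
    by apply/hasPn=> i; rewrite /= !mem_iota; lia.
  by lia.
- by rewrite size_map size_cat size_map size_iota /=; lia.
have W1 : wreath k 1 \in wreaths n k by exact: imset_f.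
apply/eqP=> /rowP/(_ (enum_rank_in W1 (wreath k 1))).
rewrite weight_row_Phi // enum_rankK_in // mxE wreath1E // big_imset /=; last first.
  by move=> x y _ _; apply: arc_inj.
(* The block arc k 0 has weight 1 and all others have weight 0. *)
rewrite (bigD1 0) //= big1 ?addr0 => [|x nz_x].
  rewrite /weight big_map big_seq big1 => [|p /msP[/andP[lt1 le2] lt2]].
    by move/eqP; rewrite oner_eq0.
  rewrite !inE !subr0 !val_Zn_nat //; last exact: leq_trans lt1 (ltnW (leq_ltn_trans le2 lt2)).
  by rewrite lt1 ltnNge le2 subr0.
apply/eqP; apply: contraNT nz_x => /weight_neq0P wx.
have q0 : ((0 : 'Z_n), (n.-1)%:R) \in qs by rewrite inE eqxx.
have q1 : ((k.-1)%:R : 'Z_n, k%:R) \in qs by rewrite !inE eqxx orbT.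
have := (wx _ q0, wx _ q1); rewrite /= !inE !val_subZn // !val_Zn_nat; try lia.
rewrite -[nat_of_ord 0]/0%N; have := ltn_Zn n_gt1 x => ltx [e1 e2].
apply/eqP/ord_inj; rewrite -[RHS]/0%N; move: (nat_of_ord x) ltx e1 e2 => m ltm.
by do 4![case: ifP => ?]; lia.
Qed.
End SeparatingArc.

(** * The eigenvalue as a polynomial in n *)

(** The hockey-stick identity, multiplied by [l.+1`!] to avoid binomials. *)
Lemma sum_ffact l k : (l.+1 * \sum_(0 <= j < k) j ^_ l = k ^_ l.+1)%N.
Proof.
elim: k => [|k IHk]; first by rewrite big_nil muln0 ffact0n.
rewrite big_nat_recr //= mulnDr IHk ffactnSr ffactSS.
have [le_lk | lt_kl] := leqP l k; last by rewrite ffact_small ?muln0.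
by rewrite [(_ * (k - l))%N]mulnC -mulnDl; congr (_ * _)%N; lia.
Qed.

Section EigenvaluePolynomial.
Variables (k l : nat).
Hypotheses (l_ge2 : (2 <= l)%N) (le_lk : (l <= k)%N).

(** The falling factorial [(n - c) ^_ m] as a polynomial in [n]. *)
Definition shifted_ffact (c m : nat) : {poly rat} :=
  \prod_(i <- iota c m) ('X - i%:R%:P).

Lemma horner_shifted_ffact c m n : (c <= n)%N ->
  (shifted_ffact c m).[n%:R] = ((n - c) ^_ m)%:R.
Proof.
move=> le_cn; elim: m => [|m IHm].
  by rewrite /shifted_ffact big_nil hornerC.
rewrite /shifted_ffact -addn1 iotaD big_cat big_seq1 hornerM -/(shifted_ffact c m) IHm.
rewrite addn1 ffactnSr natrM hornerXsubC.
have [le_m | lt_m] := leqP m (n - c); last by rewrite ffact_small ?mul0r.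
by rewrite -natrB ?subnDA //; lia.
Qed.

Lemma coef_shifted_ffact c m i : (m <= i)%N -> (shifted_ffact c m)`_i = (i == m)%:R.
Proof.
have size_sf : size (shifted_ffact c m) = m.+1 by rewrite size_prod_XsubC size_iota.
rewrite leq_eqVlt => /predU1P[<- | lt_mi].
  have: shifted_ffact c m \is monic by apply: monic_prod_XsubC.
  by rewrite monicE /lead_coef size_sf eqxx => /eqP.
by rewrite nth_default ?size_sf // gtn_eqF.
Qed.

Definition cross_poly (j : nat) : {poly rat} :=
  \sum_(s < l.+1) ((-1) ^+ s
     * ('C(l, s) * (j ^_ (l - s) * (k - j) ^_ s * (k - j) ^_ s))%:R)
     *: shifted_ffact (2 * k - j) (l - s).

Lemma horner_cross_poly j n : (j <= k)%N -> (2 * k <= n)%N ->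
  (cross_poly j).[n%:R] = overlap_cross rat n k l j.
Proof.
move=> le_jk le_2kn; rewrite /cross_poly /overlap_cross /cross horner_sum.
apply: eq_bigr => s _; rewrite hornerZ horner_shifted_ffact; last lia.
have -> : (n - (2 * k - j) = n - 2 * k + j)%N by lia.
by rewrite !natrM; ring.
Qed.

(** The summand of index [s] has degree [l - s], so only [s = 0] reaches degree
    [l]. *)
Lemma coef_cross_poly j i : (l <= i)%N -> (cross_poly j)`_i = (j ^_ l)%:R * (i == l)%:R.
Proof.
move=> le_li; rewrite coef_sum big_ord_recl big1 => [|s _].
  by rewrite coefZ subn0 coef_shifted_ffact // !ffactn0 bin0 !muln1 mul1n mul1r addr0.
rewrite coefZ coef_shifted_ffact /= /bump; last by move: l_ge2; lia.
by rewrite gtn_eqF ?mulr0 //; move: l_ge2; lia.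
Qed.

(** When [j = 0] only the summand [s = l] of [cross] survives, and it does not
    depend on [n]. *)
Definition disjoint_coef : rat := (-1) ^+ l * (k ^_ l * k ^_ l)%:R.

Lemma overlap_cross0 n : overlap_cross rat n k l 0 = disjoint_coef.
Proof.
rewrite /overlap_cross /cross big_ord_recr big1 /= => [|s _].
  by rewrite add0r subnn !ffactn0 binn subn0 muln1 !mul1n.
by rewrite ffact0n subn_eq0 leqNgt ltn_ord !(muln0, mul0n) mulr0.
Qed.

(** The polynomial of [sum_overlap]; the factor of [disjoint_coef] is the number
    [n - 2 * k + 1] of distances at which two arcs are disjoint. *)
Definition eigenvalue_poly : {poly rat} :=
  ((k - l)`!%:R / 2) *: (cross_poly k + (\sum_(1 <= j < k) cross_poly j) *+ 2
                         + disjoint_coef *: ('X - (2 * k - 1)%:R%:P)).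

Lemma horner_eigenvalue_poly n : (2 * k < n)%N ->
  eigenvalue_poly.[n%:R]
  = (k - l)`!%:R / 2 * \sum_(0 <= d < n) overlap_cross rat n k l (overlap n k d).
Proof.
move=> lt_2kn; rewrite sum_overlap //; last lia.
rewrite hornerZ; congr (_ * _); rewrite 2!hornerD hornerMn hornerZ hornerXsubC.
rewrite horner_cross_poly //; last lia.
rewrite overlap_cross0 -[_ *+ (_ + 1)]mulr_natr -natrB; last lia.
congr (_ + _ *+ 2 + _ * _%:R); last lia.
rewrite horner_sum big_nat [RHS]big_nat; apply: eq_bigr => j /andP[_ lt_jk].
by rewrite horner_cross_poly //; lia.
Qed.

(** The disjoint arcs contribute in degree at most [1 < l]. With [sum_ffact] the
    coefficient of degree [l] is
    [(k - l)! / 2 * (k ^_ l + 2 * k ^_ l.+1 / l.+1)]. *)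
Lemma coef_eigenvalue_poly i : (l <= i)%N ->
  eigenvalue_poly`_i = ((2 * k - l + 1) * k`!)%:R / (2 * (l + 1))%:R * (i == l)%:R.
Proof.
move=> le_li; rewrite coefZ 2!coefD coefMn coefZ coefB coefX coefC coef_cross_poly // coef_sum.
have -> : (i == 1)%N = false by lia.
have -> : (i == 0)%N = false by lia.
rewrite subrr mulr0 addr0.
under eq_bigr do rewrite coef_cross_poly //.
rewrite -mulr_suml -mulrnAl -mulrDl mulrA; congr (_ * _).
have sumE : l.+1%:R * (\sum_(1 <= j < k) (j ^_ l)%:R) = (k ^_ l * (k - l))%:R :> rat.
  rewrite -natr_sum -natrM -ffactnSr -sum_ffact [in RHS]big_ltn; last lia.
  by rewrite ffact_small ?add0n //; lia.
have nz_l1 : l.+1%:R != 0 :> rat by rewrite pnatr_eq0.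
have nz2l : (2 * (l + 1))%:R != 0 :> rat by rewrite pnatr_eq0; lia.
apply: (mulIf nz2l); rewrite divfK // -(ffact_fact le_lk) addn1.
transitivity ((k - l)`!%:R * (l.+1%:R * (k ^_ l)%:R
  + (l.+1%:R * \sum_(1 <= j < k) (j ^_ l)%:R) *+ 2) : rat).
  by rewrite natrM; field.
have -> : (2 * k - l + 1 = l.+1 + 2 * (k - l))%N by lia.
by rewrite sumE !natrM natrD; ring.
Qed.

Lemma size_eigenvalue_poly : size eigenvalue_poly = l.+1.
Proof.
apply/eqP; rewrite eqn_leq; apply/andP; split.
  apply/leq_sizeP => i lt_li; rewrite coef_eigenvalue_poly ?(ltnW lt_li) //.
  by rewrite gtn_eqF // mulr0.
rewrite ltnNge; apply/negP => /leq_sizeP/(_ l (leqnn l))/eqP.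
rewrite coef_eigenvalue_poly // eqxx mulr1 mulf_eq0 invr_eq0 !pnatr_eq0 -!leqn0.
have := fact_gt0 k; nia.
Qed.
End EigenvaluePolynomial.

Lemma ratr_overlap_cross (C : numFieldType) n k l j :
  ratr (overlap_cross rat n k l j) = overlap_cross C n k l j.
Proof.
rewrite rmorph_sum; apply: eq_bigr => s _.
by rewrite rmorphM rmorphXn rmorphN1 rmorph_nat.
Qed.

Lemma ratr_eigenvalue (C : numFieldType) n k l m : (2 <= l)%N -> (l <= k)%N -> (2 * k < n)%N ->
  ratr (m%:R * (eigenvalue_poly k l).[n%:R]) = ((k - l)`! * m)%:R / 2
    * \sum_(0 <= d < n) overlap_cross C n k l (overlap n k d) :> C.
Proof.
move=> l_ge2 le_lk lt_2k_n; rewrite horner_eigenvalue_poly //.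
rewrite 2!(rmorphM (@ratr C)) fmorph_div !rmorph_nat.
rewrite rmorph_sum (eq_bigr _ (fun d _ => ratr_overlap_cross C n k l (overlap n k d))).
by rewrite natrM; ring.
Qed.

Theorem corollary4p8 (k l : nat) (l_ge2 : (2 <= l)%N) (l_le_k : (l <= k)%N) :
  exists P : {poly rat},
    [/\ size P = l.+1,
        lead_coef P = ((2 * k - l + 1) * k`!)%N%:R / (2 * (l + 1))%N%:R
      & forall (C : numClosedFieldType) (n : nat),
          (2 * k < n)%N -> coprime n k ->
          forall U : nat -> 'M[C]_#|ksubsets n k|, specht_decomposition U ->
            acts_as_scalar (U l *m Phi C n k)
              (ratr (((n - k - l)`!)%:R * P.[n%:R]))].
Proof.
have k_ge2 : (2 <= k)%N by apply: leq_trans l_le_k.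
exists (eigenvalue_poly k l); split; first exact: size_eigenvalue_poly.
  by rewrite /lead_coef size_eigenvalue_poly // coef_eigenvalue_poly // eqxx mulr1.
move=> C n lt_2k_n co_nk U [specht_U _ _].
have n_gt1 : (1 < n)%N by lia.
have [|weightsU Uweights] := specht_submodule_weights n_gt1 _ (specht_U l l_le_k).
  by lia.
have [qs [Uqs size_qs qs_neq0]] := @weight_row_Phi_neq0 C n k l lt_2k_n l_ge2 l_le_k co_nk.
split.
  apply: contraNneq qs_neq0 => U0; have /submxP[w ->] := weightsU _ Uqs size_qs.
  by rewrite -mulmxA U0 mulmx0.
have [a eigen] := weight_row_eigen C k Uqs; rewrite size_qs in eigen.
have def_a := eigenvalueE k_ge2 lt_2k_n co_nk l_le_k eigen.
have U_eigen : U l *m codeg_mx C n k = a *: U l.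
  apply/eigenspaceP; apply: submx_trans Uweights _; apply/sumsmx_subP => g _.
  rewrite genmxE; apply/eigenspaceP; rewrite -weight_rowM -codeg_mx_commutes.
  rewrite eigen ?scalemxAl //; last by rewrite size_map size_iota.
  by apply: uniq_column_points; lia.
apply/eigenspaceP; rewrite wreath_mx_Phi // !mulmxA -[U l *m _ *m _]mulmxA.
rewrite -/(codeg_mx C n k) U_eigen -scalemxAl; congr (_ *: _).
by rewrite def_a ratr_eigenvalue.
Qed.
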